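(* Let $\kappa$ be an infinite cardinal and $n\in\omega$. If $\square_{\kappa^{+m}}$ holds for every $m<n$, then there exists a special $(n+1,\kappa)$-ladder of cardinality $\kappa^{+n}$.
   Context: $\square_\lambda$ is Jensen's square principle: there is $\langle C_\alpha\mid\alpha<\lambda^+\text{ limit}\rangle$ with $C_\alpha$ club in $\alpha$, $\mathrm{otp}(C_\alpha)\le\lambda$, and $C_\beta=C_\alpha\cap\beta$ whenever $\beta$ is a limit point of $C_\alpha$. For a set $X$, $\overline{X}^{\top}$ is the join-semilattice on $X\sqcup\{\mathbf 1\}$ with $x\vee y=\mathbf 1$ for all distinct $x,y$; $\overline{k}^{\top}$ is this for $X=\{0,\dots,k-1\}$. A join-semilattice is $\overline{k}^{\top}$-free if it has no join-subsemilattice isomorphic to $\overline{k}^{\top}$. An $(m,\kappa)$-semiladder is a nonempty join-semilattice that is $\overline{(m+1)}^{\top}$-free with all principal ideals of cardinality $<\kappa$; an $(m,\kappa)$-ladder is such a structure that is a lattice. Given a join-semilattice $B$ with least element $\mathbf 0_B$, an ordinal $\gamma$, and $\varrho:[\gamma]^2\to B$ (writing $\varrho(\alpha,\beta)$ for $\varrho(\{\alpha,\beta\})$, with $\varrho(\alpha,\alpha)=\mathbf 0_B$), define $\trianglelefteq_\varrho$ on $\gamma\times B$ by $(\alpha,p)\trianglelefteq_\varrho(\beta,q)$ iff $\alpha\le\beta$ and $p\vee\varrho(\alpha,\beta)\le q$. Recursively: a special $(0,\kappa)$-ladder is the trivial lattice $\{\mathbf 0\}$; for positive $n$, an $(n,\kappa)$-ladder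 $S$ is special if $S=(\gamma\times B,\trianglelefteq_\varrho)$ for some ordinal $\gamma$, some special $(n-1,\kappa)$-ladder $B$, and some $\varrho:[\gamma]^2\to B$ with $\varrho(0,\alpha)=\mathbf 0_B$ for all $\alpha<\gamma$. *)

(* Defs.v *)
From HB Require Import structures.
From mathcomp Require Import all_boot all_order.
From mathcomp Require Import boolp wochoice classical_sets functions cardinality.

Set Implicit Arguments.
Unset Strict Implicit.
Unset Printing Implicit Defensive.

Import Order.TTheory.

Local Open Scope classical_set_scope.
Local Open Scope card_scope.
Local Open Scope order_scope.

(* An ordinal is a well-ordered type, taken up to order isomorphism; its
   elements stand for the smaller ordinals. A cardinal is an initial ordinal. *)

Definition is_ordinal d (T : orderType d) : Prop := well_order (<=%O : rel T).

Definition card_lt T U (A : set T) (B : set U) : Prop :=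
  A #<= B /\ ~ (B #<= A).

Definition is_cardinal d (T : orderType d) : Prop :=
  is_ordinal T /\ forall a : T, card_lt [set b : T | b < a] [set: T].

(* M is the least cardinal greater than L *)
Definition is_succ_cardinal dL (L : orderType dL) dM (M : orderType dM) : Prop :=
  [/\ is_cardinal M,
      card_lt [set: L] [set: M] &
      forall dN (N : orderType dN), is_cardinal N ->
        card_lt [set: L] [set: N] -> [set: M] #<= [set: N]].

(* L is K^{+m}. This is a relation, as K^{+m} is only determined up to
   order isomorphism. *)
Fixpoint is_iter_succ_cardinal (m : nat) dK (K : orderType dK)
    dL (L : orderType dL) : Prop :=
  match m with
  | 0 => is_cardinal L /\ [set: L] #= [set: K]
  | m'.+1 => exists dM (M : orderType dM),
      is_iter_succ_cardinal m' K M /\ is_succ_cardinal M L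
  end.

Definition is_limit d (T : orderType d) (a : T) : Prop :=
  (exists c, c < a) /\ forall c, c < a -> exists e, c < e < a.

Definition limit_point d (T : orderType d) (A : set T) (b : T) : Prop :=
  (exists c, c < b) /\ forall c, c < b -> exists2 e, A e & c < e < b.

Definition club_in d (T : orderType d) (A : set T) (a : T) : Prop :=
  [/\ A `<=` [set b | b < a],
      forall c, c < a -> exists2 e, A e & c < e &
      forall b, b < a -> limit_point A b -> A b].

(* A is order isomorphic to an initial segment of L *)
Definition otp_le d (T : orderType d) (A : set T) dL (L : orderType dL) : Prop :=
  exists f : T -> L,
    (forall x y, A x -> A y -> (f x < f y) = (x < y)) /\
    (forall x z, A x -> z < f x -> exists2 y, A y & f y = z).

Definition square dL (L : orderType dL) : Prop :=
  exists dM (M : orderType dM), is_succ_cardinal L M /\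
  exists C : M -> set M, forall a : M, is_limit a ->
    [/\ club_in (C a) a,
        otp_le (C a) L &
        forall b, limit_point (C a) b -> C b = (C a `&` [set c | (c < b)%O])%classic].

(* The flat join-semilattice on X with a top element None adjoined *)
Definition flat_top (X : Type) : Type := option X.

HB.instance Definition _ (X : choiceType) := Choice.copy (flat_top X) (option X).

Definition flat_top_display : Order.disp_t := Order.Disp tt tt.

Section FlatTop.
Variable X : choiceType.
Implicit Types x y z : flat_top X.

Definition flat_top_le x y : bool := (x == y) || (y == None).

Definition flat_top_join x y : flat_top X := if x == y then x else None.

Lemma flat_top_le_refl : reflexive flat_top_le.
Proof. by move=> x; rewrite /flat_top_le eqxx. Qed.

Lemma flat_top_le_anti : antisymmetric flat_top_le.
Proof.
move=> x y /andP[/orP[/eqP//|/eqP->]].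
by rewrite /flat_top_le => /orP[/eqP//|/eqP->].
Qed.

Lemma flat_top_le_trans : transitive flat_top_le.
Proof.
move=> y x z /orP[/eqP->//|/eqP->]; rewrite /flat_top_le.
by case/orP => [/eqP<-|->]; rewrite orbT.
Qed.

HB.instance Definition _ := Order.Le_isPOrder.Build flat_top_display
  (flat_top X) flat_top_le_refl flat_top_le_anti flat_top_le_trans.

Lemma flat_top_joinP x y z : (flat_top_join x y <= z) = (x <= z) && (y <= z).
Proof.
rewrite /flat_top_join; case: eqVneq => [->|xy]; first by rewrite andbb.
rewrite /Order.le /= /flat_top_le; case: z => [z|]; last by rewrite !orbT.
rewrite !orbF; apply/esym/negbTE/negP => /andP[/eqP ex /eqP ey].
by rewrite ex ey eqxx in xy.
Qed.

HB.instance Definition _ := Order.POrder_isJoinSemilattice.Build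
  flat_top_display (flat_top X) flat_top_joinP.

End FlatTop.

(* No join-subsemilattice of S, that is, no range of an injective join
   morphism, is isomorphic to the flat join-semilattice on k points. *)
Definition flat_top_free (k : nat) d (S : joinSemilatticeType d) : Prop :=
  ~ exists f : flat_top 'I_k -> S,
      injective f /\ {morph f : x y / x `|` y}.

Definition is_semiladder (m : nat) dK (K : orderType dK)
    d (S : joinSemilatticeType d) : Prop :=
  [/\ inhabited S,
      flat_top_free m.+1 S &
      forall x : S, card_lt [set y : S | y <= x] [set: K]].

Definition is_ladder (m : nat) dK (K : orderType dK)
    d (S : latticeType d) : Prop := is_semiladder m K S.

(* A function on unordered pairs, extended by bottom on the diagonal, is
   encoded as a symmetric binary function. *)
Definition is_pair_function (G : Type) d (B : bJoinSemilatticeType d)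
    (rho : G -> G -> B) : Prop :=
  (forall a b, rho a b = rho b a) /\ (forall a, rho a a = \bot).

Definition tri_le dG (G : orderType dG) d (B : bJoinSemilatticeType d)
    (rho : G -> G -> B) : rel (G * B) :=
  fun x y => (x.1 <= y.1) && (x.2 `|` rho x.1 y.1 <= y.2).

(* The equality S = (G * B, tri_le rho) is read as an order isomorphism.
   Assuming a bottom element loses nothing: every special ladder has one. *)
Fixpoint is_special_ladder (n : nat) dK (K : orderType dK)
    d (S : bLatticeType d) : Prop :=
  match n with
  | 0 => forall x : S, x = \bot
  | n'.+1 =>
      is_ladder n K S /\
      exists dG (G : orderType dG) dB (B : bLatticeType dB) (rho : G -> G -> B),
        [/\ is_ordinal G,
            is_special_ladder n' K B,
            is_pair_function rho,
            forall z a : G, (forall c, z <= c) -> rho z a = \bot &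
            exists f : G * B -> S,
              bijective f /\ forall x y, (f x <= f y) = tri_le rho x y]
  end.

(* Main.v *)
(* A special ladder S of cardinality lambda = kappa^{+n} is carried along with an
   injection h of the ordinal lambda into S that maps 0 to the bottom and pulls
   principal ideals back to closed sets of ordinals. Given a square sequence on
   lambda^+, walk from b down to a through the clubs and let rho(a, b) be the
   join of the values h(otp(C_g meet x)) at the points x of the clubs C_g that
   the walk visits, and, when x is not a limit point of C_g, of the same data at
   the finitely many points of C_g between x and the last limit point before it.
   The coherence of the square sequence gives, for a <= b with rho(a, b) <= p,
   that D(a, p) is the part of D(b, p) up to a, where D(b, p) is the set of a <= b
   with rho(a, b) <= p. This is the subadditivity that makes the order on
   lambda^+ * S a join-semilattice. Each D(b, p) is closed, because h pulls
   ideals back to closed sets, so two elements (a, p) and (b, q) have the meet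
   (max (D(a, p) meet D(b, q)), p meet q). As h is injective, D(b, p) is finite
   if the ideal of p is, and has at most as many elements as this ideal
   otherwise. If k + 1 elements have the same join in pairs, then all but one
   have the same first coordinate as the join, so k second coordinates do so in
   S. The next injection is a |-> (a, bottom), which pulls the ideal of (b, p)
   back to D(b, p). *)

Require Import Defs.
From HB Require Import structures.
From mathcomp Require Import all_boot all_order.
From mathcomp Require Import boolp wochoice classical_sets functions cardinality.

Set Implicit Arguments.
Unset Strict Implicit.
Unset Printing Implicit Defensive.

Import Order.TTheory.

Local Open Scope classical_set_scope.
Local Open Scope card_scope.

(** * Cardinal arithmetic on well-orders *)

Section Cardinals.
Local Open Scope order_scope.
Local Open Scope classical_set_scope.

Lemma card_le_inj T U (A : set T) (B : set U) (f : T -> U) :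
  (forall x, A x -> B (f x)) ->
  (forall x y, A x -> A y -> f x = f y -> x = y) -> A #<= B.
Proof.
move=> fAB f_inj.
suff: $|{injfun A >-> B}| by case=> g; apply: inj_card_le.
by apply/injfunPex; exists f => // x y /set_mem Ax /set_mem Ay; apply: f_inj.
Qed.

Lemma card_le_ex T U (A : set T) (B : set U) (u : U) : A #<= B ->
  exists f : T -> U, (forall x, A x -> B (f x)) /\
    (forall x y, A x -> A y -> f x = f y -> x = y).
Proof.
move=> AB; pose V : pointedType := HB.pack U (gen_eqMixin U) (gen_choiceMixin U)
  (isPointed.Build U u).
have /pcard_leP/injfunPex[f fAB f_inj] : A #<= (B : set V) by [].
exists f; split=> // x y Ax Ay.
by apply: f_inj; apply/mem_set.
Qed.

Lemma card_le_setX T T' U U' (A : set T) (B : set U) (A' : set T') (B' : set U') :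
  A #<= B -> A' #<= B' -> A `*` A' #<= B `*` B'.
Proof.
move=> AB AB'; have [[[x x'] [/= Ax Ax']]|no] := pselect (A `*` A' !=set0); last first.
  have -> : A `*` A' = set0 by apply/eqP/negPn/negP => /set0P.
  exact: card_ge0.
have [u Bu] : B !=set0.
  by apply/set0P/eqP => B0; move: AB; rewrite B0 card_le0 => /eqP A0; rewrite A0 in Ax.
have [u' Bu'] : B' !=set0.
  by apply/set0P/eqP => B0; move: AB'; rewrite B0 card_le0 => /eqP A0; rewrite A0 in Ax'.
have [f [fB fi]] := card_le_ex u AB; have [g [gB gi]] := card_le_ex u' AB'.
apply: (@card_le_inj _ _ _ _ (fun z => (f z.1, g z.2))) => [[y y'] [/= Ay Ay']|].
  by split; [apply: fB|apply: gB].
move=> [y y'] [z z'] [/= Ay Ay'] [/= Az Az'] [fe ge].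
by rewrite (fi y z) // (gi y' z').
Qed.

(** [F] receives the values below [x] as a total function with default [a0], which keeps recursive
    definitions free of proof arguments. *)
Lemma wf_recursion T A (R : rel T) (a0 : A) (F : T -> (T -> A) -> A) :
  well_founded R ->
  exists f : T -> A, forall x, f x = F x (fun y => if R y x then f y else a0).
Proof.
move=> wfR.
pose G x (rec : forall y, R y x -> A) : A :=
  F x (fun y => if pselect (R y x) is left h then rec y h else a0).
exists (Fix wfR (fun=> A) G) => x; rewrite Fix_eq.
  by congr F; apply/funext => y; case: pselect => [->//|/negP/negbTE->].
move=> {}x f g fg; congr F; apply/funext => y.
by case: pselect => // h; rewrite fg.
Qed.

(** Each [x] in [A] is sent to a point of [B] not taken by its predecessors; they cannot have
    exhausted [B], since their image is no larger than the segment. *)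
Lemma card_le_of_segments T U (R : rel T) (A : set T) (B : set U) :
  well_founded R -> (forall x y, [\/ R x y, x = y | R y x]) ->
  (forall x, A x -> ~ (B #<= [set y | A y /\ R y x])) -> A #<= B.
Proof.
move=> wfR totR small.
have [[a Aa]|no] := pselect (A !=set0); last first.
  have -> : A = set0 by apply/eqP/negPn/negP => /set0P.
  exact: card_ge0.
have [u Bu] : B !=set0.
  by apply/set0P/eqP => B0; apply: (small _ Aa); rewrite B0; apply: card_ge0.
pose P x (f : T -> U) := B `\` f @` [set y | A y /\ R y x].
have [f fE] := wf_recursion u (fun x f => (xget (u : {classic U}) (P x f))) wfR.
have fP x : A x -> P x f (f x).
  move=> Ax.
  have : exists v, P x f v.
    apply: contrapT => no; apply: (small _ Ax).
    apply: card_le_trans (card_image_le f _); apply: subset_card_le => v Bv.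
    by apply: contrapT => nv; apply: no; exists v.
  have PE : P x f = P x (fun y => if R y x then f y else u).
    rewrite /P; congr (B `\` _).
    by apply/seteqP; split=> v [y [Ay Ryx] <-]; exists y => //; rewrite Ryx.
  by rewrite [f x]fE PE; apply: (@xgetPex {classic U}).
apply: (@card_le_inj _ _ _ _ f) => [x /fP[]//|x y Ax Ay fxy].
case: (totR x y) => // [Rxy|Ryx]; [case: (fP _ Ay)|case: (fP _ Ax)] => _ [].
  by exists x.
by exists y.
Qed.

Section Ordinals.
Context d (T : orderType d) (T_ord : is_ordinal T).

Lemma ordinal_least (A : set T) : A !=set0 ->
  exists m, A m /\ forall x, A x -> m <= x.
Proof.
move=> [a Aa]; have [|m [[/asboolP Am mP] _]] := T_ord (A := fun x => `[< A x >]).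
  by exists a; apply/asboolP.
by exists m; split=> // x Ax; apply: mP; apply/asboolP.
Qed.

Lemma ordinal_induction (P : T -> Prop) :
  (forall x, (forall y, y < x -> P y) -> P x) -> forall x, P x.
Proof.
move=> IH x; apply: contrapT => nPx.
have [m [nPm mP]] := @ordinal_least [set y | ~ P y] (ex_intro _ x nPx).
apply: nPm; apply: IH => y ym; apply: contrapT => /mP.
by rewrite leNgt ym.
Qed.

Lemma ordinal_wf X (f : X -> T) : well_founded (fun x y => f x < f y).
Proof.
suff wf a : forall x, f x = a -> Acc (fun x y => f x < f y) x by move=> x; apply: wf.
elim/ordinal_induction: a => a IH x xa.
by constructor=> y; rewrite xa => /IH; apply.
Qed.

End Ordinals.

Lemma well_orderable (T : Type) : exists d (W : orderType d) (f : T -> W),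
  is_ordinal W /\ bijective f.
Proof.
have [R R_wo] := well_ordering_principle {classic T}.
pose disp := Order.Disp tt tt.
have R_ch : wo_chain R predT by move=> A _; apply: R_wo.
have le_anti : antisymmetric R.
  by move=> x y; apply: (wo_chain_antisymmetric R_ch).
have le_total : total R by move=> x y; apply: (wo_chainW R_ch).
have le_trans : transitive R.
  move=> y x z Rxy Ryz.
  (* Transitivity is read off from the least of the three points: if it is [y] or [z], antisymmetry
     merges two of them. *)
  have [|m [[]]] := R_wo (fun w => [|| w == x, w == y | w == z]).
    by exists x; rewrite /in_mem /= eqxx.
  rewrite {1}/in_mem /= => mxyz mP _.
  have mx : R m x by apply: mP; rewrite /in_mem /= eqxx.
  have my : R m y by apply: mP; rewrite /in_mem /= eqxx orbT.
  have mz : R m z by apply: mP; rewrite /in_mem /= eqxx !orbT.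
  case/or3P: mxyz => /eqP mE; rewrite mE // in mx my mz *.
    by rewrite (le_anti x y) // Rxy mx.
  by rewrite -(le_anti y z) // Ryz my.
pose lt x y := (y != x) && R x y.
pose W : orderType disp := HB.pack {classic T}
  (@Order.isOrder.Build disp {classic T} R lt
    (fun x y => if lt x y then x else y) (fun x y => if lt x y then y else x)
    (fun=> fun=> erefl) (fun=> fun=> erefl) (fun=> fun=> erefl)
    le_anti le_trans le_total).
exists disp, W, (fun x => x); split=> //.
by exists (fun x => x).
Qed.

Lemma card_le_total T U (A : set T) (B : set U) : A #<= B \/ B #<= A.
Proof.
have [d [W [f [W_ord /bij_inj f_inj]]]] := well_orderable T.
have [[x [Ax BA]]|no] :=
    pselect (exists x, A x /\ B #<= [set y | A y /\ f y < f x]).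
  by right; apply: card_le_trans BA _; apply: subset_card_le => y [].
left; apply: (@card_le_of_segments _ _ (fun x y => f x < f y)).
- by exact: ordinal_wf.
- move=> x y; case: (ltgtP (f x) (f y)) => [||/f_inj] h.
  + by constructor 1.
  + by constructor 3.
  + by constructor 2.
- by move=> x Ax xB; apply: no; exists x.
Qed.

Lemma card_le_setU1 T (A : set T) (a : T) : infinite_set A -> A `|` [set a] #<= A.
Proof.
move=> A_inf; have [Aa|nAa] := pselect (A a).
  by apply: subset_card_le => x [|->].
have [g [gA g_inj]] := card_le_ex a (proj1 (infiniteP A) A_inf).
have gA' n : A (g n) by apply: gA.
have g_inj' : injective g by move=> m n; apply: g_inj.
pose g' x := xget 0%N [set n | g n = x].
have g'K n : g' (g n) = n.
  by apply: xget_unique => // m /g_inj'.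
(* Room for [a] is made by shifting the sequence [g] in [A] by one place. *)
pose f x := if `[< x = a >] then g 0%N else
  if `[< range g x >] then g (g' x).+1 else x.
apply: (@card_le_inj _ _ _ _ f) => [x|x y].
  move=> Ax; rewrite /f; case: (asboolP (x = a)) => [xa|xa]; first exact: gA'.
  by case: (asboolP (range g x)) => h; [apply: gA'|case: Ax].
rewrite /f => Ax Ay.
case: (asboolP (x = a)) => [->|xa]; case: (asboolP (y = a)) => [->|ya] //.
- case: (asboolP (range g y)) => [h /g_inj' //|ng ge]; exfalso.
  by apply: ng; exists 0%N.
- case: (asboolP (range g x)) => [h /g_inj' //|ng ge]; exfalso.
  by apply: ng; exists 0%N.
- case: (asboolP (range g x)) => [[m _ <-]|nx];
    case: (asboolP (range g y)) => [[n _ <-]|ny] //.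
  + by rewrite !g'K => /g_inj'[->].
  + by move=> ge; exfalso; apply: ny; rewrite -ge; exists (g' (g m)).+1.
  + by move=> ge; exfalso; apply: nx; rewrite ge; exists (g' (g n)).+1.
Qed.

(* The square is ordered by the larger coordinate first, so that a proper
   initial segment is contained in the square of a proper initial segment. *)
Lemma card_square_of_segments d (T : orderType d) (A : set T) :
  is_ordinal T -> infinite_set A ->
  (forall b c, A b -> c <= b -> A c) ->
  (forall b, A b -> infinite_set [set c | c < b] ->
     [set c | c < b] `*` [set c | c < b] #<= [set c | c < b]) ->
  A `*` A #<= A.
Proof.
move=> T_ord A_inf A_down IH.
have [[b [Ab Ale]]|no] := pselect (exists b, A b /\ A #<= [set c | c < b]).
  have b_inf : infinite_set [set c | c < b].
    by move=> bf; apply: A_inf; apply: card_le_finite bf.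
  apply: card_le_trans (card_le_setX Ale Ale) _.
  apply: card_le_trans (IH _ Ab b_inf) _.
  by apply: subset_card_le => c /= cb; apply: A_down Ab (ltW cb).
have [d' [W [f [W_ord /bij_inj f_inj]]]] := well_orderable (T * T).
pose mx (z : T * T) := Order.max z.1 z.2.
pose R (x y : T * T) := (mx x < mx y) || ((mx x == mx y) && (f x < f y)).
apply: (@card_le_of_segments _ _ R).
- suff wf a : forall z, mx z = a -> Acc R z by move=> z; apply: wf.
  elim/(ordinal_induction T_ord): a => a IHa.
  suff wf w : forall z, mx z = a -> f z = w -> Acc R z by move=> z za; apply: (wf (f z)).
  elim/(ordinal_induction W_ord): w => w IHw z za zw; constructor=> y.
  case/orP=> [|/andP[/eqP e]]; first by rewrite za => /IHa; apply.
  by rewrite zw => /IHw; apply; rewrite ?e.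
- move=> x y; rewrite /R; case: (ltgtP (mx x) (mx y)) => e.
  + by constructor 1.
  + by constructor 3.
  + case: (ltgtP (f x) (f y)) => [||/f_inj] h.
    * by constructor 1.
    * by constructor 3.
    * by constructor 2.
(* If the pairs before [z] were as many as [A], then [A] would embed in the square of [B], hence in
   the segment below [b], contrary to [no]. *)
- move=> z [Az1 Az2] small; have Az : A (mx z) by rewrite /mx /Order.max; case: ifP.
  set b := mx z in Az small.
  pose B := [set c | c < b] `|` [set b].
  have AB : A #<= B `*` B.
    apply: card_le_trans small _; apply: subset_card_le => -[y1 y2] [_ Ry].
    have : mx (y1, y2) <= b.
      by case/orP: Ry => [/ltW //|/andP[/eqP e _]]; rewrite -[b]e.
    rewrite /mx /= ge_max !le_eqVlt => /andP[h1 h2]; rewrite /B; split=> /=.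
      by case/orP: h1 => [/eqP->|]; [right|left].
    by case/orP: h2 => [/eqP->|]; [right|left].
  have [bf|b_inf] := pselect (finite_set [set c | c < b]).
    apply: A_inf; apply: card_le_finite AB _.
    by apply: finite_setX; rewrite finite_setU; split=> //; apply: finite_set1.
  have Bb : B #<= [set c | c < b] by apply: card_le_setU1.
  apply: no; exists b; split=> //.
  apply: card_le_trans AB _; apply: card_le_trans (card_le_setX Bb Bb) _.
  exact: IH.
Qed.

Lemma card_square T (A : set T) : infinite_set A -> A `*` A #<= A.
Proof.
move=> A_inf; have [d [W [f [W_ord f_bij]]]] := well_orderable A.
have [g gK fK] := f_bij.
have AW : A #= [set: W].
  apply: card_eq_trans (card_setT_sym A) _; apply/card_eqPle; split.
    by apply: (card_le_inj (f := f)) => // x y _ _ /(can_inj gK).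
  by apply: (card_le_inj (f := g)) => // x y _ _ /(can_inj fK).
have := AW; rewrite card_eqPle => -[AW1 WA].
apply: card_le_trans (card_le_setX AW1 AW1) _; apply: card_le_trans WA.
have W_sq (b : W) : infinite_set [set c | c < b] ->
    [set c | c < b] `*` [set c | c < b] #<= [set c | c < b].
  elim/(ordinal_induction W_ord): b => b IH b_inf.
  apply: card_square_of_segments => // c e /= cb ec.
  exact: le_lt_trans ec cb.
apply: card_square_of_segments => // [W_fin|b _]; last exact: W_sq.
by apply: A_inf; apply: card_le_finite AW1 W_fin.
Qed.

End Cardinals.

(** * Walks along a square sequence *)

Section Walks.
Local Open Scope order_scope.

Definition next_in d (T : orderType d) (A : set T) (a : T) : set T :=
  [set c | A c /\ a <= c /\ forall e, A e -> a <= e -> c <= e].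

Definition pred_in d (T : orderType d) (A : set T) (a : T) : set T :=
  [set c | A c /\ c < a /\ forall e, A e -> e < a -> e <= c].

Lemma next_in_uniq d (T : orderType d) (A : set T) a c c' :
  next_in A a c -> next_in A a c' -> c = c'.
Proof.
move=> [Ac [ac cP]] [Ac' [ac' c'P]]; apply/le_anti.
by rewrite cP // c'P.
Qed.

Lemma next_in_id d (T : orderType d) (A : set T) a : A a -> next_in A a a.
Proof. by split. Qed.

Lemma pred_in_uniq d (T : orderType d) (A : set T) a c c' :
  pred_in A a c -> pred_in A a c' -> c = c'.
Proof.
move=> [Ac [ac cP]] [Ac' [ac' c'P]]; apply/le_anti.
by rewrite cP // c'P.
Qed.

Lemma limit_point_no_pred d (T : orderType d) (A : set T) a c :
  limit_point A a -> ~ pred_in A a c.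
Proof.
move=> [_ lim] [Ac [ca cP]]; have [e Ae /andP[ce ea]] := lim _ ca.
by move: ce; rewrite ltNge cP.
Qed.

Section Rho.
Context dM (M : orderType dM) dL (L : orderType dL) dB (B : bLatticeType dB).
Context (C : M -> set M) (idx : M -> M -> L) (h : L -> B).

(* Here [C b] is the club of [b], [idx b x] the order type of [C b] below [x],
   and [h] the embedding of [L] into [B]. The equations determine [rho a b] for
   [a <= b] only. In the last two, a point of [C b] collects the values of [h]
   and of [rho] over the finitely many points of [C b] between it and the last
   limit point of [C b] before it. *)
Definition walk_equations (rho : M -> M -> B) : Prop :=
  [/\ forall b, rho b b = \bot,
      forall d b c, d < b -> next_in (C b) d c ->
        rho d b = rho c b `|` rho d c,
      forall x b, C b x -> ~ (exists y, pred_in (C b) x y) ->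
        rho x b = h (idx b x) &
      forall x b y, C b x -> pred_in (C b) x y ->
        rho x b = h (idx b x) `|` (rho y b `|` rho y x)].

Context (M_ord : is_ordinal M).
Hypothesis C_lt : forall b x, C b x -> x < b.
Hypothesis C_cof : forall b c, c < b -> exists2 e, C b e & c <= e.
Hypothesis C_closed : forall b x, x < b -> limit_point (C b) x -> C b x.
Hypothesis C_coh : forall b x, limit_point (C b) x ->
  C x = (C b `&` [set y | (y < x)%O])%classic.
Hypothesis idx_coh : forall b x y, limit_point (C b) x -> C x y ->
  idx x y = idx b y.
Hypothesis idx_lt : forall b x y, C b x -> C b y ->
  (idx b x < idx b y) = (x < y).
Hypothesis idx_init : forall b x z, C b x -> z < idx b x ->
  exists2 y, C b y & idx b y = z.

Lemma next_exists d b : d < b -> exists c, next_in (C b) d c.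
Proof.
move=> /C_cof[e Ce de].
have [|c [[Cc dc] cP]] := @ordinal_least _ M M_ord [set x | C b x /\ d <= x].
  by exists e.
by exists c; split=> //; split=> // x Cx dx; apply: cP.
Qed.

Lemma walk_exists : exists rho, walk_equations rho.
Proof.
have [[x0 _]|no] := pselect ([set: M] !=set0); last first.
  exists (fun _ _ => \bot); split=> [b|d b|x b|x b]; exfalso; apply: no;
    by exists b.
have wf : well_founded (fun x y : M => x < y) by apply: (ordinal_wf M_ord id).
(* Two nested recursions with swapped arguments: [f b d] will be [rho d b]. The inner one, [r b g],
   runs along [C b]; the outer one supplies [g x] for [x < b]. *)
pose G b (g : M -> M -> B) x (r : M -> B) := h (idx b x) `|`
  let y := xget x0 (pred_in (C b) x) in
  if `[< exists y, pred_in (C b) x y >] then r y `|` g x y else \bot.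
pose r b g := sval (cid (wf_recursion \bot (G b g) wf)).
have rE b g x : r b g x = G b g x (fun y => if y < x then r b g y else \bot).
  exact: (svalP (cid (wf_recursion \bot (G b g) wf))).
pose F b (g : M -> M -> B) d := let c := xget x0 (next_in (C b) d) in
  if d < b then r b g c `|` g c d else \bot.
have [f fE] := wf_recursion (fun _ => \bot) F wf.
have ff b : f b b = \bot by rewrite fE /F ltxx.
pose g b y := if y < b then f y else fun _ => \bot.
have fN d b c : d < b -> next_in (C b) d c -> f b d = r b (g b) c `|` f c d.
  move=> db cN; rewrite fE /F db.
  have -> : xget x0 (next_in (C b) d) = c.
    by apply: xget_unique => // y yN; apply: next_in_uniq yN cN.
  by rewrite (C_lt (proj1 cN)).
have fC b x : C b x -> f b x = r b (g b) x.
  by move=> Cx; rewrite (fN x b x (C_lt Cx) (next_in_id Cx)) ff joinx0.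
exists (fun d b => f b d); split=> // [d b c db cN|x b Cx nP|x b y Cx yP].
- by rewrite (fN _ _ _ db cN) (fC _ _ (proj1 cN)).
- by rewrite (fC _ _ Cx) rE /G; case: asboolP => // _; rewrite joinx0.
- have [Cy [yx _]] := yP.
  rewrite (fC _ _ Cx) rE /G; case: asboolP => [_|[]]; last by exists y.
  have -> : xget x0 (pred_in (C b) x) = y.
    by apply: xget_unique => // z zP; apply: pred_in_uniq zP yP.
  by rewrite yx (fC _ _ Cy) /g (C_lt Cx).
Qed.

Context (rho : M -> M -> B) (rho_walk : walk_equations rho).

Let rho_id b : rho b b = \bot. Proof. by case: rho_walk. Qed.

Let rho_next p d b c : d < b -> next_in (C b) d c ->
  (rho d b <= p) = (rho c b <= p) && (rho d c <= p).
Proof. by case: rho_walk => _ H _ _ db cN; rewrite (H _ _ _ db cN) leUx. Qed.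

Let rho_first x b : C b x -> ~ (exists y, pred_in (C b) x y) ->
  rho x b = h (idx b x).
Proof. by case: rho_walk => _ _ H _; apply: H. Qed.

Let rho_pred p x b y : C b x -> pred_in (C b) x y ->
  (rho x b <= p) = [&& h (idx b x) <= p, rho y b <= p & rho y x <= p].
Proof. by case: rho_walk => _ _ _ H Cx yP; rewrite (H _ _ _ Cx yP) !leUx. Qed.

Let rho_h p x b : C b x -> rho x b <= p -> h (idx b x) <= p.
Proof.
move=> Cx; have [[y yP]|nP] := pselect (exists y, pred_in (C b) x y).
  by rewrite (rho_pred _ Cx yP) => /andP[].
by rewrite rho_first.
Qed.

(** If [y] is not a limit point, there is a least bound [v < y] of the club points below [y]. It
    lies in the club, since otherwise it would be a limit point of it. *)
Let pred_or_limit b y x : C b y -> C b x -> x < y ->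
  (exists z, pred_in (C b) y z) \/ limit_point (C b) y.
Proof.
move=> Cy Cx xy; have [lim|nlim] := pselect (limit_point (C b) y); [by right|left].
have [u [uy uP]] : exists u, u < y /\ forall e, C b e -> e < y -> e <= u.
  apply: contrapT => no; apply: nlim; split; first by exists x.
  move=> c cy; apply: contrapT => nc; apply: no; exists c; split=> // e Ce ey.
  by rewrite leNgt; apply/negP => ce; apply: nc; exists e => //; rewrite ce.
have [|v [[vy vP] vm]] :=
    @ordinal_least _ M M_ord [set u | u < y /\ forall e, C b e -> e < y -> e <= u].
  by exists u.
exists v; split; last by [].
apply: contrapT => nCv; apply: (nCv); apply: C_closed.
  exact: lt_trans vy (C_lt Cy).
have C_ltv e : C b e -> e < y -> e < v.
  move=> Ce ey; rewrite lt_neqAle vP // andbT; apply/eqP => ev.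
  by apply: nCv; rewrite -ev.
split; first by exists x; apply: C_ltv.
move=> c cv; apply: contrapT => nc; have : v <= c.
  apply: vm; split; first exact: lt_trans cv vy.
  move=> e Ce ey; rewrite leNgt; apply/negP => ce; apply: nc.
  by exists e => //; rewrite ce C_ltv.
by rewrite leNgt cv.
Qed.

Let limit_in b x y : limit_point (C b) x -> C x y -> C b y /\ y < x.
Proof. by move=> lim; rewrite (C_coh lim). Qed.

(** [C y] is an initial segment of [C b] with the same indices and predecessors, so both sides
    unfold by the same equations. *)
Let rho_limit p b y x : limit_point (C b) y -> C y x ->
  (rho x y <= p) = (rho x b <= p).
Proof.
move=> lim; elim/(ordinal_induction M_ord): x => x IH Cyx.
have [Cx xy] := limit_in lim Cyx.
have predE z : pred_in (C y) x z <-> pred_in (C b) x z.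
  rewrite /pred_in /= (C_coh lim) /=; split=> -[Cz [zx zP]].
    split; first by case: Cz.
    by split=> // e Ce ex; apply: zP => //; split=> //; apply: lt_trans xy.
  by do ![split=> //] => [|e [Ce _] ex]; [apply: lt_trans xy|apply: zP].
have [[z zP]|nP] := pselect (exists z, pred_in (C b) x z).
  have zP' := proj2 (predE z) zP; have [Cyz [zx _]] := zP'.
  by rewrite (rho_pred _ Cx zP) (rho_pred _ Cyx zP') (idx_coh lim Cyx) IH.
rewrite rho_first // => [|[z /predE zP]]; last by apply: nP; exists z.
by rewrite (rho_first Cx nP) (idx_coh lim Cyx).
Qed.

(** The equivalence packs two subadditivity laws: [rho d b] lies below the join of [rho d a] and
    [rho a b], and [rho d a] below the join of [rho d b] and [rho a b]. *)
Definition coherent_at b := forall p d a, d <= a -> a <= b -> rho a b <= p ->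
  (rho d a <= p) = (rho d b <= p).

(** * Coherence of walks, by induction on the larger ordinal *)

Section Coherence.
Context (b : M) (IHb : forall y, y < b -> coherent_at y).

(** Induction on [y]. If [z] precedes [y] in the club, [rho y b] already collects [rho z b] and
    [rho z y], and coherence at [y] carries the bound on [rho x z] over to [rho x y]. For a limit
    point [y], [rho_limit] applies. *)
Let rho_club p x y : C b x -> C b y -> x <= y -> rho x b <= p -> rho y b <= p ->
  rho x y <= p.
Proof.
move=> Cx Cy xy rx; elim/(ordinal_induction M_ord): y => y IH in Cy xy *.
move: xy; rewrite le_eqVlt => /orP[/eqP<- _|xy ry]; first by rewrite rho_id le0x.
have [[z zP]|lim] := pred_or_limit Cy Cx xy.
  have [Cz [zy zmax]] := zP; have xz : x <= z by apply: zmax.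
  move: ry; rewrite (rho_pred _ Cy zP) => /and3P[_ rz rzy].
  by rewrite -(IHb (C_lt Cy) xz (ltW zy) rzy); apply: IH.
by rewrite (rho_limit p lim) // (C_coh lim).
Qed.

(** Descent from [y] to the first club point [c] at or above [d]: a predecessor [z] of [y] takes the
    place of [y] by coherence at [y], and from a limit point [y] the walk to [d] also passes through
    [c]. *)
Let rho_through_club p d y : C b y -> d <= y -> rho y b <= p -> rho d y <= p ->
  rho d b <= p.
Proof.
elim/(ordinal_induction M_ord): y => y IH Cy dy ry rdy.
have [c cN] := next_exists (le_lt_trans dy (C_lt Cy)).
have [Cc [dc cP]] := cN.
have db : d < b := le_lt_trans dy (C_lt Cy).
rewrite (rho_next p db cN).
have := cP _ Cy dy; rewrite le_eqVlt => /orP[/eqP->|cy]; first by rewrite ry rdy.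
have [[z zP]|lim] := pred_or_limit Cy Cc cy.
  have [Cz [zy zmax]] := zP; have cz : c <= z by apply: zmax.
  move: ry; rewrite (rho_pred _ Cy zP) => /and3P[_ rz rzy].
  rewrite -(rho_next p db cN); apply: (IH z) => //; first exact: le_trans cz.
  by rewrite (IHb (C_lt Cy) _ (ltW zy)) //; apply: le_trans cz.
have Cyc : C y c by rewrite (C_coh lim).
have cN' : next_in (C y) d c.
  by split=> //; split=> // e /(limit_in lim)[Ce _]; apply: cP.
move: rdy; rewrite (rho_next p (le_lt_trans dc cy) cN').
by rewrite (rho_limit p lim).
Qed.

Lemma coherent_step : coherent_at b.
Proof.
move=> p d a da; rewrite le_eqVlt => /orP[/eqP-> //|ab] ra.
have [c cN] := next_exists ab; have [Cc [ac cP]] := cN.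
move: (ra); rewrite (rho_next p ab cN) => /andP[rcb rac].
have cb := C_lt Cc.
(* Coherence at [c] replaces [a] by the club point [c]; it remains to compare [rho d c] with
   [rho d b]. *)
rewrite (IHb cb da ac rac); apply/idP/idP => rd.
  by apply: rho_through_club rd => //; apply: le_trans ac.
have db := le_lt_trans da ab.
have [e eN] := next_exists db; have [Ce [de eP]] := eN.
move: rd; rewrite (rho_next p db eN) => /andP[reb rde].
have ec : e <= c by apply: eP => //; apply: le_trans ac.
by rewrite -(IHb cb de ec) //; apply: rho_club.
Qed.

End Coherence.

Lemma walk_coherent b : coherent_at b.
Proof. by elim/(ordinal_induction M_ord): b => b; apply: coherent_step. Qed.

(** The walk to the least ordinal [z] steps to the minimum of [C b], which has the least index and
    no predecessor. *)
Lemma walk_bot z b : (forall i, (forall j, i <= j) -> h i = \bot) ->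
  (forall c, z <= c) -> rho z b = \bot.
Proof.
move=> h_bot z_min; elim/(ordinal_induction M_ord): b => b IH.
have := z_min b; rewrite le_eqVlt => /orP[/eqP->|zb]; first exact: rho_id.
have [c cN] := next_exists zb; have [Cc [_ cP]] := cN.
have idx_min j : idx b c <= j.
  rewrite leNgt; apply/negP => jc; have [y Cy yj] := idx_init Cc jc.
  have yc : y < c by rewrite -(idx_lt Cy Cc) yj.
  by move: yc; rewrite ltNge cP.
apply/eqP; rewrite -lex0 (rho_next _ zb cN) (IH c (C_lt Cc)) le0x andbT.
rewrite rho_first // ?h_bot // => -[y [Cy [yc _]]].
by move: yc; rewrite ltNge cP.
Qed.

Lemma walk_closed p b d :
  (forall i, limit_point [set j | h j <= p] i -> h i <= p) ->
  d <= b -> limit_point [set x | x <= b /\ rho x b <= p] d -> rho d b <= p.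
Proof.
move=> h_closed; elim/(ordinal_induction M_ord): b => b IH.
rewrite le_eqVlt => /orP[/eqP-> _|db lim]; first by rewrite rho_id le0x.
have [c cN] := next_exists db; have [Cc [dc cP]] := cN.
(* If [d] is a limit point of [C b], then [rho d b] is a single value of [h]. The set accumulating
   at [d] yields club points cofinal in [d] whose [h] values lie below [p], so closedness of [h]
   applies. *)
have [limC|nlimC] := pselect (limit_point (C b) d).
  have Cd := C_closed db limC.
  rewrite rho_first //; last by move=> [y]; apply: limit_point_no_pred.
  apply: h_closed; have below y : C b y -> y < d ->
      exists2 e, C b e /\ h (idx b e) <= p & y < e < d.
    move=> Cy yd; have [x [xb rx] /andP[yx xd]] := lim.2 _ yd.
    have [e' Ce' /andP[xe' e'd]] := limC.2 _ xd.
    have [e eN] := next_exists (lt_trans xd db); have [Ce [xe eP]] := eN.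
    move: rx; rewrite (rho_next _ (lt_trans xd db) eN) => /andP[re _].
    exists e; first by split=> //; apply: rho_h.
    by rewrite (lt_le_trans yx xe) (le_lt_trans _ e'd) // eP // ltW.
  split.
    have [c0 c0d] := limC.1; have [e Ce /andP[_ ed]] := limC.2 _ c0d.
    by exists (idx b e); rewrite idx_lt.
  move=> i id; have [y Cy yi] := idx_init Cd id.
  have [|e [Ce he] /andP[ye ed]] := below y Cy; first by rewrite -(idx_lt Cy Cd) yi.
  by exists (idx b e) => //; rewrite -yi !idx_lt // ye.
(* Otherwise no club point lies strictly between some [u < d] and [d]. All [x] in between share the
   next club point [c] with [d], and the induction hypothesis at [c] applies. *)
have [u [ud uP]] : exists u, u < d /\ forall e, C b e -> u < e -> d <= e.
  apply: contrapT => no; apply: nlimC; split; first exact: lim.1.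
  move=> u ud; apply: contrapT => nu; apply: no; exists u; split=> // e Ce ue.
  by rewrite leNgt; apply/negP => ed; apply: nu; exists e => //; rewrite ue.
have key x : u < x -> x < d -> rho x b <= p -> rho c b <= p /\ rho x c <= p.
  move=> ux xd; rewrite (rho_next (c := c) _ (lt_trans xd db)).
    by move/andP.
  split=> //; split=> [|e Ce xe]; first exact: le_trans (ltW xd) dc.
  by apply: cP => //; apply: uP => //; apply: lt_le_trans xe.
rewrite (rho_next _ db cN); have [x [xb rx] /andP[ux xd]] := lim.2 _ ud.
have [-> _] := key _ ux xd rx; apply: IH; [exact: C_lt|exact: dc|].
split; first by exists u.
move=> v vd; have [|w [wb rw] /andP[]] := lim.2 (Order.max u v).
  by rewrite gt_max ud.
rewrite gt_max => /andP[uw vw] wd; have [_ rwc] := key _ uw wd rw.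
exists w; last by rewrite vw.
by split=> //; apply: le_trans (ltW wd) dc.
Qed.

(* [small] stands for finiteness when the principal ideal of [p] is finite, and
   otherwise for having at most as many elements as this ideal; this covers
   singular [K], for which [card_lt _ [set: K]] is not closed under unions of
   fewer than [K] sets. *)
Lemma walk_small (h_inj : injective h) p (small : set (set M)) :
  (forall A A', A `<=` A' -> small A' -> small A) ->
  (forall A a, small A -> small (A `|` [set a])%classic) ->
  (forall I F, I #<= [set q | q <= p] -> (forall i : M, I i -> small (F i)) ->
    small (\bigcup_(i in I) F i)) ->
  forall b, small [set x | x <= b /\ rho x b <= p].
Proof.
move=> smallS smallU smallB; elim/(ordinal_induction M_ord) => b IH.
(* Every [x < b] in the set is reached through a club point in [I], and [I] is no larger than the
   ideal of [p] because [h] and [idx b] are injective on the club. *)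
pose I : set M := [set y | C b y /\ h (idx b y) <= p].
pose F y : set M := [set x | x <= y /\ rho x y <= p].
apply: (smallS _ (\bigcup_(y in I) F y `|` [set b])%classic).
  move=> x [xb rx]; move: (xb); rewrite le_eqVlt => /orP[/eqP->|xb']; [by right|left].
  have [c cN] := next_exists xb'; have [Cc [xc _]] := cN.
  move: rx; rewrite (rho_next _ xb' cN) => /andP[rc rxc].
  by exists c => //; split=> //; apply: rho_h.
apply: smallU; apply: smallB => [|y [Cy _]]; last by apply/IH/C_lt.
apply: (card_le_inj (f := fun y => h (idx b y))) => [y []//|x y [Cx _] [Cy _]].
move=> /h_inj xy; case: (ltgtP x y) => //.
  by rewrite -(idx_lt Cx Cy) xy ltxx.
by rewrite -(idx_lt Cy Cx) xy ltxx.
Qed.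

End Rho.
End Walks.

(** * Sets of cardinality less than [K], and bounded unions *)

Section SmallSets.
Context dK (K : orderType dK) (K_infinite : infinite_set [set: K]).

Lemma finite_card_le T U (A : set T) (B : set U) :
  finite_set A -> infinite_set B -> A #<= B.
Proof.
move=> A_fin B_inf; have [//|BA] := card_le_total A B.
by case: B_inf; apply: card_le_finite A_fin.
Qed.

Lemma card_lt_sub T U (A : set T) (B : set U) : A #<= B ->
  card_lt B [set: K] -> card_lt A [set: K].
Proof.
move=> AB [BK KB]; split; first exact: card_le_trans AB BK.
by move=> KA; apply: KB; apply: card_le_trans KA AB.
Qed.

Lemma card_lt_finite T (A : set T) : finite_set A -> card_lt A [set: K].
Proof.
move=> A_fin; split; first exact: finite_card_le.
by move=> KA; apply: K_infinite; apply: card_le_finite A_fin.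
Qed.

Lemma card_lt_setX T U (A : set T) (B : set U) :
  card_lt A [set: K] -> card_lt B [set: K] -> card_lt (A `*` B) [set: K].
Proof.
move=> AK BK.
have sq V (X : set V) : card_lt X [set: K] -> A #<= X -> B #<= X ->
    card_lt (A `*` B) [set: K].
  move=> XK AX BX; have [X_fin|X_inf] := pselect (finite_set X).
    apply: card_lt_finite; apply: finite_setX.
      exact: card_le_finite AX X_fin.
    exact: card_le_finite BX X_fin.
  apply: card_lt_sub XK; apply: card_le_trans (card_le_setX AX BX) _.
  exact: card_square.
by have [AB|BA] := card_le_total A B; [apply: (sq _ B)|apply: (sq _ A)].
Qed.

End SmallSets.

(** An element is coded by a chosen index together with its code in that member; such pairs fit into
    the infinite set [X]. *)
Lemma card_le_bigcup I T U (D : set I) (F : I -> set T) (X : set U) :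
  infinite_set X -> D #<= X -> (forall i, D i -> F i #<= X) ->
  \bigcup_(i in D) F i #<= X.
Proof.
move=> X_inf DX FX; apply: card_le_trans (card_square X_inf).
have [u Xu] := infinite_setN0 X_inf.
have [g [gX g_inj]] := card_le_ex u DX.
have /choice[f fP] : forall i, exists f : T -> U, D i ->
    (forall x, F i x -> X (f x)) /\
    (forall x y, F i x -> F i y -> f x = f y -> x = y).
  move=> i; have [Di|nDi] := pselect (D i); last by exists (fun=> u).
  by have [f fP] := card_le_ex u (FX i Di); exists f.
have [[x0 [i0 _ _]]|no] := pselect (\bigcup_(i in D) F i !=set0); last first.
  have -> : \bigcup_(i in D) F i = set0 by apply/eqP/negPn/negP => /set0P.
  exact: card_ge0.
have /choice[k kP] : forall x, exists i, (\bigcup_(i in D) F i) x -> D i /\ F i x.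
  move=> x; have [[i Di Fx]|nx] := pselect ((\bigcup_(i in D) F i) x).
    by exists i.
  by exists i0.
apply: (card_le_inj (f := fun x => (g (k x), f (k x) x))) => [x Ux|x y Ux Uy].
  have [Dk Fk] := kP x Ux; split; first exact: gX.
  exact: (fP _ Dk).1.
have [Dx Fx] := kP x Ux; have [Dy Fy] := kP y Uy.
case=> /(g_inj _ _ Dx Dy) kxy fxy; rewrite -kxy in Fy fxy.
exact: (fP _ Dx).2.
Qed.

(** * Clubs and indices from a square sequence *)

Section SquareSequence.
Local Open Scope order_scope.
Local Open Scope classical_set_scope.

(* Successors are given their predecessor as the only element of the club, so
   that every nonzero ordinal can be walked down from. *)
Lemma square_walk_data dL (L : orderType dL) dM (M : orderType dM) (l0 : L)
    (C0 : M -> set M) :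
  is_ordinal M -> (forall l, l0 <= l) ->
  (forall a : M, is_limit a ->
    [/\ club_in (C0 a) a, otp_le (C0 a) L &
        forall b, limit_point (C0 a) b -> C0 b = C0 a `&` [set c | c < b]]) ->
  exists (C : M -> set M) (idx : M -> M -> L),
  [/\ (forall b x, C b x -> x < b) /\
        (forall b c, c < b -> exists2 e, C b e & c <= e),
      forall b x, x < b -> limit_point (C b) x -> C b x,
      (forall b x, limit_point (C b) x -> C x = C b `&` [set y | y < x]) /\
        (forall b x y, limit_point (C b) x -> C x y -> idx x y = idx b y),
      forall b x y, C b x -> C b y -> (idx b x < idx b y) = (x < y) &
      forall b x z, C b x -> z < idx b x -> exists2 y, C b y & idx b y = z].
Proof.
move=> M_ord l0_min C0P.
have /choice[f fP] : forall a : M, exists f : M -> L, is_limit a ->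
    (forall x y, C0 a x -> C0 a y -> (f x < f y) = (x < y)) /\
    (forall x z, C0 a x -> z < f x -> exists2 y, C0 a y & f y = z).
  move=> a; have [/C0P[_ [f fP] _]|] := pselect (is_limit a); first by exists f.
  by exists (fun=> l0).
pose C b := if `[< is_limit b >] then C0 b else pred_in [set: M] b.
pose idx b := if `[< is_limit b >] then f b else fun=> l0.
have CE b : is_limit b -> C b = C0 b by rewrite /C; case: asboolP.
have idxE b : is_limit b -> idx b = f b by rewrite /idx; case: asboolP.
(* A set with at most one element has no limit points, so these occur only in the clubs of the given
   sequence. *)
have C_lim b x : limit_point (C b) x -> [/\ is_limit b, is_limit x & limit_point (C0 b) x].
  rewrite /C; case: asboolP => [bl lim|nbl lim].
    split=> //; split; first exact: lim.1.
    by move=> c /lim.2[e _ h]; exists e.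
  have [c cx] := lim.1; have [e [_ [eb eP]] /andP[_ ex]] := lim.2 _ cx.
  have [e' [_ [eb' eP']] /andP[ee' _]] := lim.2 _ ex.
  by move: ee'; rewrite ltNge eP.
have C0_coh b x : is_limit b -> limit_point (C0 b) x ->
    C0 x = C0 b `&` [set y | y < x].
  by move=> /C0P[_ _]; apply.
exists C, idx; split; first split.
- move=> b x; rewrite /C; case: asboolP => [/C0P[[sub _ _] _ _]|_ [_ []//]].
  exact: sub.
- move=> b c cb; rewrite /C; case: asboolP => [/C0P[[_ cof _] _ _]|nbl].
    by have [e Ce /ltW] := cof _ cb; exists e.
  have [e [eb eP]] : exists e, e < b /\ forall x, x < b -> x <= e.
    apply: contrapT => no; apply: nbl; split; first by exists c.
    move=> x xb; apply: contrapT => nx; apply: no; exists x; split=> // y yb.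
    by rewrite leNgt; apply/negP => xy; apply: nx; exists y; rewrite xy.
  by exists e; [split=> //; split=> // x _; apply: eP|apply: eP].
- move=> b x xb /[dup] /C_lim[bl _ lim] _; rewrite CE //.
  by have [[_ _ cl] _ _] := C0P _ bl; apply: cl.
- split.
    by move=> b x /C_lim[bl xl lim]; rewrite !CE // (C0_coh b).
  move=> b x y /C_lim[bl xl lim]; rewrite CE // !idxE //.
  have [fx_lt fx_init] := fP x xl; have [fb_lt fb_init] := fP b bl.
  have C0E z : C0 x z <-> C0 b z /\ z < x by rewrite (C0_coh b).
  (* Both [f x] and [f b] have initial segments of [L] as ranges. If they first differed at [y], the
     smaller value would be attained earlier, where they agree. *)
  elim/(ordinal_induction M_ord): y => y IH Cy.
  have [Cby yx] := (C0E y).1 Cy.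
  case: (ltgtP (f x y) (f b y)) => // lt.
    have [z Cz fz] := fb_init _ _ Cby lt.
    have zy : z < y by rewrite -fb_lt // fz.
    have Cxz : C0 x z by apply/C0E; split=> //; apply: lt_trans zy yx.
    by move: zy; rewrite -(fx_lt _ _ Cxz Cy) (IH z) // ?fz ?ltxx // -fb_lt // fz.
  have [z Cz fz] := fx_init _ _ Cy lt.
  have zy : z < y by rewrite -fx_lt // fz.
  have [Cbz _] := (C0E z).1 Cz.
  by move: zy; rewrite -(fb_lt _ _ Cbz Cby) -(IH z) // ?fz ?ltxx // -fx_lt // fz.
- move=> b x y; rewrite /C /idx; case: asboolP => [/fP[H _]|_]; first exact: H.
  move=> [_ [xb xP]] [_ [yb yP]]; rewrite ltxx.
  by have /le_anti -> : x <= y <= x; [rewrite xP // yP|rewrite ltxx].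
- move=> b x z; rewrite /C /idx; case: asboolP => [/fP[_ H]|_ _]; first exact: H.
  by rewrite ltNge l0_min.
Qed.

End SquareSequence.

(** * Ladders from coherent functions *)

Section Ladders.
Local Open Scope order_scope.

(** What the ladder construction takes from the walks. The constant [\bot] on the cardinal [K] also
    qualifies and starts the induction. *)
Definition ladder_function dK (K : orderType dK) dM (M : orderType dM)
    dB (B : bLatticeType dB) (rho : M -> M -> B) : Prop :=
  [/\ forall b, rho b b = \bot,
      forall p d a b, d <= a -> a <= b -> rho a b <= p ->
        (rho d a <= p) = (rho d b <= p),
      forall z b, (forall c, z <= c) -> rho z b = \bot,
      forall p b d, d <= b ->
        limit_point [set x | x <= b /\ rho x b <= p] d -> rho d b <= p &
      forall p b, card_lt [set x | x <= b /\ rho x b <= p] [set: K]].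

Definition closed_embedding dL (L : orderType dL) dB (B : bLatticeType dB)
    (h : L -> B) : Prop :=
  [/\ injective h,
      forall i, (forall j, i <= j) -> h i = \bot &
      forall p i, limit_point [set j | h j <= p] i -> h i <= p].

Lemma square_ladder_function dK (K : orderType dK) dL (L : orderType dL)
    dM (M : orderType dM) dB (B : bLatticeType dB) (h : L -> B)
    (C : M -> set M) :
  infinite_set [set: K] -> is_ordinal L -> [set: L] !=set0 -> is_ordinal M ->
  closed_embedding h ->
  (forall p : B, card_lt [set q | q <= p] [set: K]) ->
  (forall a : M, is_limit a ->
    [/\ club_in (C a) a, otp_le (C a) L &
        forall b, limit_point (C a) b -> C b = (C a `&` [set c | (c < b)%O])%classic]) ->
  exists rho : M -> M -> B, ladder_function K rho.
Proof.
move=> K_inf L_ord L0 M_ord [h_inj h_bot h_closed] B_small CP.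
have [l0 [_ l0_min]] := ordinal_least L_ord L0.
have l0_le l : l0 <= l by apply: l0_min.
have [C' [idx [[C_lt C_cof] C_cl [C_coh idx_coh] idx_lt idx_init]]] :=
  square_walk_data M_ord l0_le CP.
have [rho rho_walk] := walk_exists idx h M_ord C_lt.
exists rho; split.
- by case: rho_walk.
- move=> p d a b; exact: (walk_coherent M_ord C_lt C_cof C_cl C_coh idx_coh rho_walk).
- move=> z b; exact: (walk_bot M_ord C_lt C_cof idx_lt idx_init rho_walk b h_bot).
- move=> p b d; exact: (walk_closed M_ord C_lt C_cof C_cl idx_lt idx_init rho_walk (h_closed p)).
- move=> p; have small := walk_small M_ord C_lt C_cof idx_lt rho_walk h_inj (p := p).
  have [p_fin|p_inf] := pselect (finite_set [set q | q <= p]) => b.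
    apply: card_lt_finite => //; apply: (small finite_set).
    + by move=> A A' AA'; apply: sub_finite_set.
    + by move=> A a A_fin; rewrite finite_setU; split=> //; apply: finite_set1.
    + by move=> I F IP; apply: bigcup_finite; apply: card_le_finite IP _.
  apply: card_lt_sub (B_small p); apply: (small (fun A => A #<= [set q | q <= p])).
  + by move=> A A' AA'; apply: card_le_trans; apply: subset_card_le.
  + move=> A a Ap; have [A_fin|A_inf] := pselect (finite_set A).
      apply: finite_card_le => //.
      by rewrite finite_setU; split=> //; apply: finite_set1.
    by apply: card_le_trans Ap; apply: card_le_setU1.
  + by move=> I F IP; apply: card_le_bigcup.
Qed.

(** Joins and meets only need to exist: choice turns them into operations, and their universal
    properties are the axioms of the structure. *)
Lemma lattice_realization T (le : rel T) (bot : T) :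
  reflexive le -> antisymmetric le -> transitive le -> (forall x, le bot x) ->
  (forall x y, exists z, forall w, le z w = le x w && le y w) ->
  (forall x y, exists z, forall w, le w z = le w x && le w y) ->
  exists d (S : bLatticeType d) (f : T -> S),
    bijective f /\ forall x y, (f x <= f y) = le x y.
Proof.
move=> le_refl le_anti le_trans bot_le joinP meetP.
pose disp := Order.Disp tt tt.
have /choice[join1 join1P] : forall xy : T * T, exists z,
    forall w, le z w = le xy.1 w && le xy.2 w by move=> xy; apply: joinP.
have /choice[meet1 meet1P] : forall xy : T * T, exists z,
    forall w, le w z = le w xy.1 && le w xy.2 by move=> xy; apply: meetP.
pose P : porderType disp := HB.pack {classic T}
  (@Order.Le_isPOrder.Build disp {classic T} le le_refl le_anti le_trans).
pose S : bLatticeType disp := HB.pack P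
  (@Order.POrder_MeetJoin_isLattice.Build disp P
     (fun x y => meet1 (x, y)) (fun x y => join1 (x, y))
     (fun x y z => meet1P (y, z) x) (fun x y z => join1P (x, y) z))
  (@Order.hasBottom.Build disp P bot bot_le).
exists disp, S, (fun x => x); split=> //.
by exists (fun x => x).
Qed.

(** * The ordered product: joins, meets, ideals and flat subsemilattices *)

Section Step.
Context dK (K : orderType dK) (K_inf : infinite_set [set: K]).
Context dM (M : orderType dM) (M_ord : is_ordinal M).
Context dB (B : bLatticeType dB) (rho : M -> M -> B).
Hypothesis rho_ladder : ladder_function K rho.

(** The walk equations fix [rho a b] only for [a <= b], while a pair function has to be
    symmetric. *)
Definition symmetrized a b := rho (Order.min a b) (Order.max a b).

Lemma symmetrized_pair : is_pair_function symmetrized.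
Proof.
split=> [a b|a]; first by rewrite /symmetrized minC maxC.
by rewrite /symmetrized minxx maxxx; case: rho_ladder.
Qed.

Lemma symmetrized_bot z a : (forall c, z <= c) -> symmetrized z a = \bot.
Proof.
move=> z_min; rewrite /symmetrized min_l // max_r //.
by case: rho_ladder => _ _ H _ _; apply: H.
Qed.

Let le := tri_le symmetrized.

Lemma tri_le_symmetrized x y :
  tri_le symmetrized x y = [&& x.1 <= y.1, x.2 <= y.2 & rho x.1 y.1 <= y.2].
Proof.
rewrite /tri_le; case: (boolP (x.1 <= y.1)) => //= xy.
by rewrite leUx /symmetrized min_l // max_r.
Qed.

Let leE x y : le x y = [&& x.1 <= y.1, x.2 <= y.2 & rho x.1 y.1 <= y.2].
Proof. exact: tri_le_symmetrized. Qed.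

Let rho_id b : rho b b = \bot. Proof. by case: rho_ladder. Qed.
Let coh p d a b : d <= a -> a <= b -> rho a b <= p ->
  (rho d a <= p) = (rho d b <= p).
Proof. by case: rho_ladder => _ H _ _ _; apply: H. Qed.

Let tri_refl : reflexive le.
Proof. by move=> x; rewrite leE !lexx rho_id le0x. Qed.

Let tri_anti : antisymmetric le.
Proof.
move=> [a p] [b q]; rewrite !leE /= => /andP[/and3P[ab pq _] /and3P[ba qp _]].
by congr (_, _); apply: le_anti; apply/andP.
Qed.

Let tri_trans : transitive le.
Proof.
move=> [b q] [a p] [c r]; rewrite !leE /=.
move=> /and3P[ab pq rq] /and3P[bc qr rr]; apply/and3P; split.
- exact: le_trans bc.
- exact: le_trans qr.
- by rewrite -(coh ab bc rr); apply: le_trans qr.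
Qed.

Let tri_join x y : exists z, forall w, le z w = le x w && le y w.
Proof.
wlog xy : x y / x.1 <= y.1.
  move=> H; case: (leP x.1 y.1) => [/H//|/ltW/H[z zP]].
  by exists z => w; rewrite zP andbC.
(* For a common bound [(c, r)], coherence trades [rho x.1 c <= r] for [rho x.1 y.1 <= r]. *)
exists (y.1, x.2 `|` y.2 `|` rho x.1 y.1) => -[c r]; rewrite !leE /= !leUx.
apply/idP/idP.
  case/and3P=> yc /andP[/andP[xr yr] rr] ryc.
  by rewrite xr yr yc ryc (le_trans xy yc) -(coh xy yc ryc) rr.
case/andP=> /and3P[xc xr rxc] /and3P[yc yr ryc].
by rewrite xr yr yc ryc (coh xy yc ryc) rxc.
Qed.

Let tri_meet (z0 : M) x y : (forall c, z0 <= c) ->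
  exists z, forall w, le w z = le w x && le w y.
Proof.
move=> z0_min.
pose D a p : set M := [set c | c <= a /\ rho c a <= p].
have D0 a p : D a p z0.
  split=> //; suff -> : rho z0 a = \bot by apply: le0x.
  by case: rho_ladder => _ _ H _ _; apply: H.
pose U : set M := [set u | forall c, D x.1 x.2 c -> D y.1 y.2 c -> c <= u].
(* [m] is the supremum of the common elements. If it were not attained, it would be a limit of them,
   and closedness would put it in both sets. *)
have [|m [Um m_min]] := @ordinal_least _ M M_ord U; first by exists x.1 => c [].
have mx : m <= x.1 by apply: m_min => c [].
have my : m <= y.1 by apply: m_min => c _ [].
have [Dx Dy] : D x.1 x.2 m /\ D y.1 y.2 m.
  have [//|nD] := pselect (D x.1 x.2 m /\ D y.1 y.2 m).
  have cof c : c < m -> exists2 e, D x.1 x.2 e /\ D y.1 y.2 e & c < e < m.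
    move=> cm; apply: contrapT => no.
    suff /m_min : U c by rewrite leNgt cm.
    move=> e ex ey; rewrite leNgt; apply/negP => ce; apply: no; exists e => //.
    rewrite ce lt_neqAle Um // andbT; apply/eqP => em.
    by apply: nD; rewrite -em.
  have z0m : z0 < m.
    rewrite lt_neqAle z0_min andbT; apply/eqP => zm.
    by apply: nD; rewrite -zm.
  have closed a p : m <= a -> (forall e, D x.1 x.2 e /\ D y.1 y.2 e -> D a p e) ->
      D a p m.
    move=> ma sub; split=> //; case: rho_ladder => _ _ _ H _; apply: H => //.
    split; first by exists z0.
    by move=> c /cof[e /sub De ce]; exists e.
  by split; apply: closed => // e [].
exists (m, x.2 `&` y.2) => -[c r]; rewrite !leE /= lexI.
apply/idP/idP.
  rewrite lexI; case/and3P => cm /andP[rx ry] /andP[rcx rcy].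
  rewrite (le_trans cm mx) (le_trans cm my) rx ry /=.
  by rewrite -(coh cm mx Dx.2) rcx -(coh cm my Dy.2) rcy.
case/andP => /and3P[cx rx rcx] /and3P[cy ry rcy].
have cm : c <= m by apply: Um.
by rewrite cm rx ry lexI (coh cm mx Dx.2) rcx (coh cm my Dy.2) rcy.
Qed.

Let tri_small x : (forall p : B, card_lt [set q | q <= p] [set: K]) ->
  card_lt [set y | le y x] [set: K].
Proof.
move=> B_small; case: x => b q.
have D_small : card_lt [set x | x <= b /\ rho x b <= q] [set: K].
  by case: rho_ladder => _ _ _ _; apply.
apply: card_lt_sub (card_lt_setX K_inf D_small (B_small q)).
apply: subset_card_le => -[a p] /=; rewrite leE /=.
by case/and3P.
Qed.

Lemma tri_lattice_exists : [set: M] !=set0 ->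
  exists d (S : bLatticeType d) (f : M * B -> S),
    bijective f /\ forall x y, (f x <= f y) = tri_le symmetrized x y.
Proof.
move=> M0; have [z0 [_ z0P]] := ordinal_least M_ord M0.
have z0_min c : z0 <= c by apply: z0P.
apply: (@lattice_realization _ _ (z0, \bot)) => //.
- move=> x; rewrite -/le leE /= z0_min !le0x.
  by case: rho_ladder => _ _ -> //= _ _; rewrite le0x.
- by move=> x y; apply: tri_meet.
Qed.

Lemma tri_flat_top_free n d (S : bLatticeType d) (f : M * B -> S) :
  bijective f -> (forall x y, (f x <= f y) = tri_le symmetrized x y) ->
  flat_top_free n.+1 B -> flat_top_free n.+2 S.
Proof.
move=> [f' fK f'K] fE B_free [g [g_inj g_join]]; apply: B_free.
have {}fE x y : (f x <= f y) = le x y by [].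
pose k i := f' (g i).
have kE i : g i = f (k i) by rewrite /k f'K.
have k_inj : injective k by move=> i j; move/(can_inj f'K)/g_inj.
have top_join i j : i != j -> g (Some i) `|` g (Some j) = g None.
  move=> ij; rewrite -g_join; congr g; rewrite /Order.join /= /flat_top_join.
  by case: eqP => // -[] /eqP; rewrite (negbTE ij).
pose b := (k None).1; pose q := (k None).2.
have kN : k None = (b, q) by rewrite /b /q; case: (k None).
have k_le i : le (k (Some i)) (b, q).
  by rewrite -kN -fE -!kE leEjoin -g_join.
have k_ub i j z : i != j -> le (k (Some i)) z -> le (k (Some j)) z -> le (b, q) z.
  move=> ij iz jz; rewrite -kN -fE -kE -(top_join i j ij) leUx !kE !fE.
  by rewrite iz jz.
(* A pair with first coordinate [(k (Some j)).1] and a large enough second one bounds both points,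
   hence also their join [(b, q)]. *)
have k_max i j : i != j -> (k (Some i)).1 <= (k (Some j)).1 -> (k (Some j)).1 = b.
  move=> ij kij; apply: le_anti.
  have := k_le j; rewrite leE => /and3P[-> _ _] /=.
  have := @k_ub i j ((k (Some j)).1, (k (Some i)).2 `|` (k (Some j)).2
    `|` rho (k (Some i)).1 (k (Some j)).1) ij.
  rewrite !leE /= kij lexx rho_id le0x leUr -joinA leUl joinCA leUl /=.
  by move=> /(_ isT isT) /andP[].
have k_b i j : i != j -> (k (Some i)).1 != b -> (k (Some j)).1 = b.
  move=> ij ib; case: (leP (k (Some i)).1 (k (Some j)).1) => [|/ltW]; first exact: k_max.
  by move/k_max => h; rewrite h ?eqxx // in ib; rewrite eq_sym.
(* At most one point has a first coordinate other than [b]. [i0] is that point, or arbitrary if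
   there is none, and [lift i0] numbers the other [n.+1] points. *)
have [i0 i0P] : exists i0, forall i, i0 != i -> (k (Some i)).1 = b.
  have [[i0 i0b]|no] := pselect (exists i, (k (Some i)).1 != b).
    by exists i0 => i /k_b; apply.
  by exists ord0 => i _; apply/eqP/negPn/negP => ib; apply: no; exists i.
pose g' (o : flat_top 'I_n.+1) := if o is Some i then (k (Some (lift i0 i))).2 else q.
have kL i : k (Some (lift i0 i)) = (b, (k (Some (lift i0 i))).2).
  by rewrite -(i0P (lift i0 i)) ?neq_lift //; case: (k _).
exists g'; split.
  move=> [i|] [j|] //= e.
  - have : k (Some (lift i0 i)) = k (Some (lift i0 j)) by rewrite kL e -kL.
    by move/k_inj/Some_inj/lift_inj ->.
  - by have /k_inj : k (Some (lift i0 i)) = k None by rewrite kL e kN.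
  - by have /k_inj : k None = k (Some (lift i0 j)) by rewrite kL -e kN.
have le_q i : (k (Some (lift i0 i))).2 <= q.
  by have := k_le (lift i0 i); rewrite leE => /and3P[].
move=> [i|] [j|]; rewrite {1}/Order.join /= /flat_top_join /=.
- case: (eqVneq i j) => [->|ij]; first by rewrite eqxx joinxx.
  have -> : (Some i == Some j :> flat_top _) = false by apply/eqP => -[] /eqP; rewrite (negbTE ij).
  (* Paired with [b], the join in [B] bounds both points of the product, hence also [(b, q)]. *)
  apply: le_anti; rewrite /= leUx !le_q andbT.
  have := @k_ub (lift i0 i) (lift i0 j)
    (b, (k (Some (lift i0 i))).2 `|` (k (Some (lift i0 j))).2).
  rewrite (inj_eq lift_inj) ij kL [k (Some (lift i0 j))]kL !leE /= lexx rho_id le0x leUl leUr /=.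
  by apply.
- by rewrite join_r.
- by rewrite join_l.
- by rewrite joinxx.
Qed.

Lemma tri_semiladder n d (S : bLatticeType d) (f : M * B -> S) :
  [set: M] !=set0 ->
  bijective f -> (forall x y, (f x <= f y) = tri_le symmetrized x y) ->
  flat_top_free n.+1 B -> (forall p : B, card_lt [set q | q <= p] [set: K]) ->
  is_semiladder n.+1 K S.
Proof.
move=> [a _] f_bij fE B_free B_small; split.
- by apply: inhabits; exact: (f (a, \bot)).
- exact: tri_flat_top_free f_bij fE B_free.
- move=> x; have [f' fK f'K] := f_bij.
  apply: card_lt_sub (tri_small (f' x) B_small).
  apply: (card_le_inj (f := f')) => [y /= yx|y z _ _ /(can_inj f'K)//].
  by rewrite /le -fE !f'K.
Qed.

Lemma tri_closed_embedding d (S : bLatticeType d) (f : M * B -> S) :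
  bijective f -> (forall x y, (f x <= f y) = tri_le symmetrized x y) ->
  closed_embedding (fun a => f (a, \bot)).
Proof.
move=> f_bij fE; have [f' fK f'K] := f_bij; split.
- by move=> a b /(can_inj fK)[].
- move=> i i_min; apply: le_anti; rewrite le0x andbT -[X in _ <= X]f'K fE.
  rewrite tri_le_symmetrized /= i_min le0x.
  by case: rho_ladder => _ _ -> //= _ _; rewrite le0x.
- move=> x a; rewrite -[x]f'K; case: (f' x) => b q lim.
  rewrite fE tri_le_symmetrized /= le0x /=.
  have ab : a <= b.
    rewrite leNgt; apply/negP => /lim.2[c /=].
    rewrite fE tri_le_symmetrized /= => /and3P[cb _ _] /andP[bc _].
    by move: bc; rewrite ltNge cb.
  rewrite ab; case: rho_ladder => _ _ _ H _; apply: H => //.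
  split; first exact: lim.1.
  move=> c /lim.2[e /=]; rewrite fE tri_le_symmetrized /= => /and3P[eb _ re] ce.
  by exists e.
Qed.

End Step.

(** * Induction on the number of successor steps *)

Lemma special_ladder_small n dK (K : orderType dK) d (S : bLatticeType d) :
  infinite_set [set: K] -> is_special_ladder n K S ->
  flat_top_free n.+1 S /\ forall p : S, card_lt [set q | q <= p] [set: K].
Proof.
(* A special ladder of rank 0 is a single point and carries no ladder clause, so both bounds are
   checked directly. *)
move=> K_inf; case: n => [S0|n [[_ S_free S_small] _]] //; split.
  move=> [f [f_inj _]].
  by have /f_inj : f (Some ord0) = f None by rewrite (S0 (f (Some ord0))) (S0 (f None)).
move=> p; apply: card_lt_finite => //; apply: sub_finite_set (finite_set1 p).
by move=> q _; rewrite /= (S0 q) (S0 p).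
Qed.

Lemma special_ladder_step n dK (K : orderType dK) dM (M : orderType dM)
    dB (B : bLatticeType dB) (rho : M -> M -> B) :
  infinite_set [set: K] -> is_ordinal M -> infinite_set [set: M] ->
  is_special_ladder n K B -> [set: B] #<= [set: M] -> ladder_function K rho ->
  exists d (S : bLatticeType d) (h : M -> S),
    [/\ is_special_ladder n.+1 K S, [set: S] #= [set: M] & closed_embedding h].
Proof.
move=> K_inf M_ord M_inf B_special BM rhoP.
have M0 := infinite_setN0 M_inf.
have [B_free B_small] := special_ladder_small K_inf B_special.
have [d [S [f [f_bij fE]]]] := tri_lattice_exists M_ord rhoP M0.
have hP := tri_closed_embedding rhoP f_bij fE.
exists d, S, (fun a => f (a, \bot)); split=> //.
- split; first exact: tri_semiladder f_bij fE B_free B_small.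
  exists dM, M, dB, B, (symmetrized rho); split=> //.
  + exact: symmetrized_pair rhoP.
  + by move=> z a; apply: (symmetrized_bot rhoP).
  + by exists f.
- have [f' fK f'K] := f_bij; rewrite card_eqPle; split.
    apply: card_le_trans (card_square M_inf).
    apply: card_le_trans (card_le_setX (card_lexx [set: M]) BM).
    by apply: (card_le_inj (f := f')) => // x y _ _ /(can_inj f'K).
  apply: (card_le_inj (f := fun a => f (a, \bot))) => // x y _ _.
  by case: hP => h_inj _ _ /h_inj.
Qed.

Lemma trivial_lattice : exists d (B : bLatticeType d), forall x : B, x = \bot.
Proof.
have [||||||d [B [f [[g fK gK] _]]]] := @lattice_realization unit (fun _ _ => true) tt.
- by [].
- by move=> [] [].
- by [].
- by [].
- by exists tt.
- by exists tt.
by exists d, B => x; rewrite -[x]gK -[\bot]gK; case: (g x); case: (g \bot).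
Qed.

(** The theorem strengthened for induction: [h] labels the clubs of the next stage, and an infinite
    [L] makes [M] infinite, so that [M * B] has the size of [M]. *)
Lemma ladder_induction n dK (K : orderType dK) :
  is_cardinal K -> infinite_set [set: K] ->
  (forall m : nat, (m < n)%N -> forall dL (L : orderType dL),
     is_iter_succ_cardinal m K L -> square L) ->
  exists dL (L : orderType dL) d (S : bLatticeType d) (h : L -> S),
    [/\ is_iter_succ_cardinal n K L /\ is_cardinal L, infinite_set [set: L],
        is_special_ladder n.+1 K S, [set: S] #= [set: L] & closed_embedding h].
Proof.
move=> K_card K_inf; elim: n => [_|n IH squares].
  have K_ord : is_ordinal K by case: K_card.
  (* With [B] trivial the ladder is a copy of [K]; its ideals have fewer than [K] elements because
     [K] is an infinite initial ordinal. *)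
  have [d0 [B B0]] := trivial_lattice.
  have [||d [S [h [S_special SK hP]]]] :=
      @special_ladder_step 0 _ K _ K _ B (fun _ _ => \bot) K_inf K_ord K_inf B0.
  - have [a _] := infinite_setN0 K_inf.
    apply: (card_le_inj (f := fun=> a)) => // x y _ _ _.
    by rewrite (B0 x) (B0 y).
  - split=> // p b; have [_ /(_ b) K_lt] := K_card.
    have sub : [set x | x <= b /\ (\bot : B) <= p] `<=`
        ([set x | x < b] `|` [set b])%classic.
      by move=> x [xb _]; move: xb; rewrite le_eqVlt => /orP[/eqP->|]; [right|left].
    have [b_fin|b_inf] := pselect (finite_set [set x | x < b]).
      apply: card_lt_finite => //; apply: sub_finite_set sub _.
      by rewrite finite_setU; split=> //; apply: finite_set1.
    apply: card_lt_sub K_lt; apply: card_le_trans (subset_card_le sub) _.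
    exact: card_le_setU1.
  by exists dK, K, d, S, h; split=> //; split=> //; split.
have [|dL [L [dB [B [h [[L_iter L_card] L_inf B_special BL hP]]]]]] := IH.
  by move=> m mn; apply: squares; apply: ltnW.
(* The square principle brings its own representative [M] of the successor of [L], which becomes the
   [L] of the next stage. *)
have [dM [M [LM [C CP]]]] := squares n (ltnSn n) dL L L_iter.
have [M_card [L_le_M _] _] := LM.
have M_ord : is_ordinal M by case: M_card.
have L_ord : is_ordinal L by case: L_card.
have M_inf : infinite_set [set: M].
  by move=> M_fin; apply: L_inf; apply: card_le_finite M_fin.
have [B_free B_small] := special_ladder_small K_inf B_special.
have [rho rhoP] :=
  square_ladder_function K_inf L_ord (infinite_setN0 L_inf) M_ord hP B_small CP.
have BM : [set: B] #<= [set: M].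
  by move: BL; rewrite card_eqPle => -[BL _]; apply: card_le_trans L_le_M.
have [d [S [h' [S_special SM h'P]]]] :=
  special_ladder_step K_inf M_ord M_inf B_special BM rhoP.
by exists dM, M, d, S, h'; split=> //; split=> //; exists dL, L.
Qed.

End Ladders.

Theorem theorem7p1 (dK : Order.disp_t) (K : orderType dK) (n : nat)
    (K_cardinal : is_cardinal K) (K_infinite : infinite_set [set: K])
    (squares : forall m : nat, (m < n)%N ->
       forall (dL : Order.disp_t) (L : orderType dL),
         is_iter_succ_cardinal m K L -> square L) :
  exists (dL : Order.disp_t) (L : orderType dL)
         (d : Order.disp_t) (S : bLatticeType d),
    [/\ is_iter_succ_cardinal n K L,
        is_special_ladder n.+1 K S &
        [set: S] #= [set: L]].
Proof.
have [dL [L [d [S [h [[L_iter _] _ S_special SL _]]]]]] :=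
  ladder_induction K_cardinal K_infinite squares.
by exists dL, L, d, S.
Qed.
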